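(* The category $\mathsf{bGA}$ of Gödel algebras with Boolean constant is dually equivalent to the category $\mathsf{bGS}$ of bG-spaces.
   Context: A Gödel algebra is $(A,\wedge,\vee,\to,t,\bot)$ with $(A,\wedge,\vee)$ a bounded lattice with top $t$ and bottom $\bot$, $a\wedge b\le c\iff a\le b\to c$, and $(a\to b)\vee(b\to a)=t$. A bG-algebra is a Gödel algebra with a constant $f$ satisfying $a\vee(a\to f)=t$ for all $a$; $\mathsf{bGA}$ has all homomorphisms as morphisms. A Priestley space $(X,\le,\tau)$ is a compact space with a partial order such that $x\not\le y$ implies some clopen up-set contains $x$ but not $y$; it is Esakia if $\downarrow U$ is clopen for all clopen $U$. A poset is a forest if ${\uparrow}x$ is a chain for every $x$. A bG-space is $(X,\le,D,\tau)$ where $(X,\le,\tau)$ is an Esakia space, $(X,\le)$ is a forest, and $D$ is a clopen set of $\le$-minimal elements. A $\mathsf{bGS}$-morphism $\varphi\colon X\to Y$ is a continuous p-morphism ($\varphi$ isotone and $\varphi(x)\le z$ implies $\exists y\ge x$ with $\varphi(y)=z$) with $\varphi[D_X]\subseteq D_Y$ and $\varphi[X\setminus D_X]\subseteq Y\setminus D_Y$. *)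

(* Defs.v *)
From HB Require Import structures.
From mathcomp Require Import all_boot all_order.
From mathcomp Require Import all_classical topology.

Set Implicit Arguments.
Unset Strict Implicit.
Unset Printing Implicit Defensive.

Local Open Scope classical_set_scope.

(** * Categories *)

Record category := Category {
  obj :> Type;
  hom : obj -> obj -> Type;
  idm : forall X, hom X X;
  compose : forall X Y Z, hom Y Z -> hom X Y -> hom X Z;
  compose_idl : forall X Y (f : hom X Y), compose (idm Y) f = f;
  compose_idr : forall X Y (f : hom X Y), compose f (idm X) = f;
  composeA : forall W X Y Z (f : hom Y Z) (g : hom X Y) (h : hom W X),
    compose f (compose g h) = compose (compose f g) h
}.

Arguments idm {c} X.
Arguments compose {c X Y Z} g f.

Definition opposite (C : category) : category :=
  @Category C (fun X Y => hom Y X) (fun X => idm X)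
    (fun X Y Z g f => compose f g)
    (fun X Y f => compose_idr f)
    (fun X Y f => compose_idl f)
    (fun W X Y Z f g h => esym (composeA h g f)).

Record functor (C D : category) := Functor {
  fobj :> C -> D;
  fmap : forall X Y, hom X Y -> hom (fobj X) (fobj Y);
  fmap_id : forall X, fmap (idm X) = idm (fobj X);
  fmap_compose : forall X Y Z (g : hom Y Z) (f : hom X Y),
    fmap (compose g f) = compose (fmap g) (fmap f)
}.

Arguments fmap {C D} f0 {X Y} f.

Definition functor_id (C : category) : functor C C :=
  @Functor C C (fun X => X) (fun X Y f => f)
    (fun X => erefl) (fun X Y Z g f => erefl).

Lemma functor_comp_id (C D E : category) (G : functor D E) (F : functor C D)
  (X : C) : fmap G (fmap F (idm X)) = idm (G (F X)).
Proof. by rewrite !fmap_id. Qed.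

Lemma functor_comp_compose (C D E : category) (G : functor D E)
  (F : functor C D) (X Y Z : C) (g : hom Y Z) (f : hom X Y) :
  fmap G (fmap F (compose g f)) =
  compose (fmap G (fmap F g)) (fmap G (fmap F f)).
Proof. by rewrite !fmap_compose. Qed.

Definition functor_comp (C D E : category) (G : functor D E)
    (F : functor C D) : functor C E :=
  @Functor C E (fun X => G (F X)) (fun X Y f => fmap G (fmap F f))
    (functor_comp_id G F) (@functor_comp_compose C D E G F).

Definition is_iso (C : category) (X Y : C) (f : hom X Y) : Prop :=
  exists g : hom Y X, compose g f = idm X /\ compose f g = idm Y.

Definition naturally_isomorphic (C D : category) (F G : functor C D) : Prop :=
  exists eta : forall X : C, hom (F X) (G X),
    (forall (X Y : C) (f : hom X Y),
       compose (eta Y) (fmap F f) = compose (fmap G f) (eta X)) /\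
    (forall X : C, is_iso (eta X)).

Definition equivalent (C D : category) : Prop :=
  exists (F : functor C D) (G : functor D C),
    naturally_isomorphic (functor_id C) (functor_comp G F) /\
    naturally_isomorphic (functor_comp F G) (functor_id D).

Definition dually_equivalent (C D : category) : Prop :=
  equivalent (opposite C) D.

(* MathComp's order structures are indexed by a display, which only drives the
   printing of notations; all objects below use the default one. *)
Local Notation disp := (Order.Disp tt tt).

(** * Gödel algebras with a Boolean constant *)

Record is_godel_algebra (A : tbLatticeType disp) (imp : A -> A -> A) : Prop :=
  IsGodelAlgebra {
    godel_residuation :
      forall a b c : A, (a `&` b <= c)%O <-> (a <= imp b c)%O;
    godel_prelinearity : forall a b : A, (imp a b `|` imp b a)%O = \top%O
  }.

Record bGalgebra := BGAlgebra {
  bGa_lattice :> tbLatticeType disp;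
  imp : bGa_lattice -> bGa_lattice -> bGa_lattice;
  bconst : bGa_lattice;
  bGa_godel : is_godel_algebra imp;
  bGa_bool : forall a : bGa_lattice, (a `|` imp a bconst)%O = \top%O
}.

Arguments imp {b} a b : rename.
Arguments bconst {b}.

Record is_bGhom (A B : bGalgebra) (h : A -> B) : Prop := IsBGHom {
  bGhom_meet : forall a b, h (a `&` b)%O = (h a `&` h b)%O;
  bGhom_join : forall a b, h (a `|` b)%O = (h a `|` h b)%O;
  bGhom_imp : forall a b, h (imp a b) = imp (h a) (h b);
  bGhom_top : h \top%O = \top%O;
  bGhom_bot : h \bot%O = \bot%O;
  bGhom_const : h bconst = bconst
}.

Record bGhom (A B : bGalgebra) := BGHom {
  bGhom_fun :> A -> B;
  bGhomP : is_bGhom bGhom_fun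
}.

Lemma bGhom_eq (A B : bGalgebra) (g h : bGhom A B) :
  bGhom_fun g = bGhom_fun h -> g = h.
Proof.
case: g h => [g gP] [h hP] /= gh; case: _ / gh hP => hP.
by congr BGHom; exact: Prop_irrelevance.
Qed.

Lemma is_bGhom_id (A : bGalgebra) : is_bGhom (fun a : A => a).
Proof. by []. Qed.

Lemma is_bGhom_comp (A B C : bGalgebra) (h : bGhom B C) (g : bGhom A B) :
  is_bGhom (fun a => h (g a)).
Proof.
by case: h g => [h []] hI hU him hT hB hc [g []] gI gU gim gT gB gc; split => /=
  [a b|a b|a b|||]; rewrite ?(gI, gU, gim, gT, gB, gc)
                            ?(hI, hU, him, hT, hB, hc).
Qed.

Definition bGhom_id (A : bGalgebra) : bGhom A A := BGHom (is_bGhom_id A).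

Definition bGhom_comp (A B C : bGalgebra) (h : bGhom B C) (g : bGhom A B) :
  bGhom A C := BGHom (is_bGhom_comp h g).

Lemma bGhom_compidl (A B : bGalgebra) (h : bGhom A B) :
  bGhom_comp (bGhom_id B) h = h.
Proof. exact: bGhom_eq. Qed.

Lemma bGhom_compidr (A B : bGalgebra) (h : bGhom A B) :
  bGhom_comp h (bGhom_id A) = h.
Proof. exact: bGhom_eq. Qed.

Lemma bGhom_compA (A B C D : bGalgebra) (f : bGhom C D) (g : bGhom B C)
  (h : bGhom A B) :
  bGhom_comp f (bGhom_comp g h) = bGhom_comp (bGhom_comp f g) h.
Proof. exact: bGhom_eq. Qed.

Definition bGA : category :=
  @Category bGalgebra bGhom bGhom_id bGhom_comp
    bGhom_compidl bGhom_compidr bGhom_compA.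

(** * bG-spaces *)

Section OrderedSpaces.
Variable X : POrderedTopological.type disp.

Definition up_set (U : set X) : Prop :=
  forall x y : X, U x -> (x <= y)%O -> U y.

Definition down_closure (U : set X) : set X :=
  [set x | exists2 y, U y & (x <= y)%O].

Definition priestley_space : Prop :=
  compact [set: X] /\
  forall x y : X, ~ (x <= y)%O ->
    exists U : set X, [/\ clopen U, up_set U, U x & ~ U y].

Definition esakia_space : Prop :=
  priestley_space /\ forall U : set X, clopen U -> clopen (down_closure U).

Definition forest : Prop :=
  forall x y z : X, (x <= y)%O -> (x <= z)%O -> (y <= z)%O \/ (z <= y)%O.

Definition minimal_elt (x : X) : Prop := forall y : X, (y <= x)%O -> y = x.

End OrderedSpaces.

Record bGspace := BGSpace {
  bGs_space :> POrderedTopological.type disp;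
  bGs_D : set bGs_space;
  bGs_esakia : esakia_space bGs_space;
  bGs_forest : forest bGs_space;
  bGs_clopen : clopen bGs_D;
  bGs_minimal : forall x, bGs_D x -> minimal_elt x
}.

Record is_bGmorphism (X Y : bGspace) (phi : X -> Y) : Prop := IsBGMorphism {
  bGm_continuous : continuous phi;
  bGm_isotone : forall x y : X, (x <= y)%O -> (phi x <= phi y)%O;
  bGm_lift : forall (x : X) (z : Y), (phi x <= z)%O ->
    exists2 y : X, (x <= y)%O & phi y = z;
  bGm_D : phi @` (@bGs_D X) `<=` @bGs_D Y;
  bGm_setCD : phi @` (~` @bGs_D X) `<=` ~` (@bGs_D Y)
}.

Record bGmorphism (X Y : bGspace) := BGMorphism {
  bGm_fun :> X -> Y;
  bGmP : is_bGmorphism bGm_fun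
}.

Lemma bGm_eq (X Y : bGspace) (f g : bGmorphism X Y) :
  bGm_fun f = bGm_fun g -> f = g.
Proof.
case: f g => [f fP] [g gP] /= fg; case: _ / fg gP => gP.
by congr BGMorphism; exact: Prop_irrelevance.
Qed.

Lemma is_bGmorphism_id (X : bGspace) : is_bGmorphism (fun x : X => x).
Proof.
split => //; first by move=> x.
- by move=> x z xz; exists z.
- by move=> _ [x Dx <-].
- by move=> _ [x Dx <-].
Qed.

Lemma is_bGmorphism_comp (X Y Z : bGspace) (g : bGmorphism Y Z)
  (f : bGmorphism X Y) : is_bGmorphism (fun x => g (f x)).
Proof.
case: g f => [g [gc gi gl gD gC]] [f [fc fi fl fD fC]]; split => /=.
- by move=> x; apply: continuous_comp; [exact: fc|exact: gc].
- by move=> x y /fi/gi.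
- move=> x z /gl[y /fl[x' xx' <-] <-]; by exists x'.
- by move=> _ [x Dx <-]; apply: gD; exists (f x) => //; apply: fD; exists x.
- by move=> _ [x Dx <-]; apply: gC; exists (f x) => //; apply: fC; exists x.
Qed.

Definition bGm_id (X : bGspace) : bGmorphism X X :=
  BGMorphism (is_bGmorphism_id X).

Definition bGm_comp (X Y Z : bGspace) (g : bGmorphism Y Z)
  (f : bGmorphism X Y) : bGmorphism X Z := BGMorphism (is_bGmorphism_comp g f).

Lemma bGm_compidl (X Y : bGspace) (f : bGmorphism X Y) :
  bGm_comp (bGm_id Y) f = f.
Proof. exact: bGm_eq. Qed.

Lemma bGm_compidr (X Y : bGspace) (f : bGmorphism X Y) :
  bGm_comp f (bGm_id X) = f.
Proof. exact: bGm_eq. Qed.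

Lemma bGm_compA (W X Y Z : bGspace) (f : bGmorphism Y Z) (g : bGmorphism X Y)
  (h : bGmorphism W X) :
  bGm_comp f (bGm_comp g h) = bGm_comp (bGm_comp f g) h.
Proof. exact: bGm_eq. Qed.

Definition bGS : category :=
  @Category bGspace bGmorphism bGm_id bGm_comp
    bGm_compidl bGm_compidr bGm_compA.

(* Main.v *)
(** Esakia duality restricted to forests with a marked clopen set of minimal
    points.  An algebra [A] is sent to its prime filters, with the neighbourhood
    base [{Q | a \in Q, b \notin Q}]; a space is sent to its clopen up-sets,
    with [U -> V] the complement of the down-closure of [U \ V].  Prelinearity
    corresponds to the forest condition and [a \/ (a -> f) = t] to minimality of
    the points outside [f].  The core is that the down-closure of a
    clopen set of prime filters is the complement of [{Q | c \in Q}] for some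
    [c]: this gives both the Esakia condition and the surjectivity of the Stone
    map. *)

From HB Require Import structures.
From mathcomp Require Import all_boot all_order all_classical topology.
Require Import Defs.

Set Implicit Arguments.
Unset Strict Implicit.
Unset Printing Implicit Defensive.

Import Order.Theory.

Local Open Scope classical_set_scope.

Local Notation disp := (Order.Disp tt tt).

(** * Prime filters *)

Record lattice_filter (A : tbLatticeType disp) (F : A -> Prop) : Prop :=
  LatticeFilter {
    lfilter_top : F \top%O;
    lfilter_up : forall a b : A, F a -> (a <= b)%O -> F b;
    lfilter_meet : forall a b : A, F a -> F b -> F (a `&` b)%O
  }.

Record lattice_ideal (A : tbLatticeType disp) (I : A -> Prop) : Prop :=
  LatticeIdeal {
    lideal_bot : I \bot%O;
    lideal_down : forall a b : A, I b -> (a <= b)%O -> I a;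
    lideal_join : forall a b : A, I a -> I b -> I (a `|` b)%O
  }.

Record prime_filter (A : tbLatticeType disp) (P : A -> Prop) : Prop :=
  PrimeFilter {
    pfilter_filter :> lattice_filter P;
    pfilter_bot : ~ P \bot%O;
    pfilter_join : forall a b : A, P (a `|` b)%O -> P a \/ P b
  }.

(** This is the filter generated by [F] and [a]. It serves to test maximality in the prime filter
    theorem and as the starting filter in [spec_impN]. *)
Lemma lattice_filter_add (A : tbLatticeType disp) (F : A -> Prop) (a : A) :
  lattice_filter F ->
  lattice_filter [set c | exists2 p, F p & (p `&` a <= c)%O].
Proof.
move=> [FT Fup FI]; split=> [|b c [p Fp pb] bc|b c [p Fp pb] [q Fq qc]] /=.
- by exists \top%O => //; exact: lex1.
- by exists p => //; exact: le_trans bc.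
- exists (p `&` q)%O; first exact: FI.
  rewrite lexI; apply/andP; split.
    by apply: le_trans pb; rewrite leI2 // leIl.
  by apply: le_trans qc; rewrite leI2 // leIr.
Qed.

Lemma lattice_filter_chain (A : tbLatticeType disp) (C : set (set A)) :
  C !=set0 -> (forall F, C F -> lattice_filter F) -> total_on C subset ->
  lattice_filter (\bigcup_(F in C) F).
Proof.
move=> [F0 CF0] CP tot; split.
- by exists F0 => //; exact: lfilter_top (CP _ CF0).
- move=> a b [F CF Fa] ab; exists F => //; exact: lfilter_up (CP _ CF) _ _ Fa ab.
- move=> a b [F CF Fa] [G CG Gb]; have [FG|GF] := tot _ _ CF CG.
    by exists G => //; apply: (lfilter_meet (CP _ CG)) => //; exact: FG.
  by exists F => //; apply: (lfilter_meet (CP _ CF)) => //; exact: GF.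
Qed.

(** By Zorn, take a filter maximal among those containing [F] and disjoint from [I]. Primality of
    such a filter needs distributivity, which residuation supplies. *)
Theorem prime_filter_separation (A : tbLatticeType disp) (imp : A -> A -> A)
    (F I : set A) :
  (forall a b c : A, (a `&` b <= c)%O <-> (a <= imp b c)%O) ->
  lattice_filter F -> lattice_ideal I -> (forall a, F a -> ~ I a) ->
  exists P : A -> Prop,
    [/\ prime_filter P, forall a, F a -> P a & forall a, P a -> ~ I a].
Proof.
move=> res fF [I0 Idown IU] FI.
pose good (G : set A) :=
  [/\ lattice_filter G, F `<=` G & forall a, G a -> ~ I a].
(* The empty set is added so that the empty chain has an upper bound. *)
have [C|P [[P0|gP] Pmax]] := @Zorn_bigcup A [set G | G = set0 \/ good G].
- move=> CP tot; have [[G [CG [a Ga]]]|C0] :=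
    pselect (exists G, C G /\ G !=set0); last first.
    left; rewrite -subset0 => a [G CG Ga]; apply: C0.
    by exists G; split => //; exists a.
  have gG : good G by case: (CP _ CG) => // G0; move: Ga; rewrite G0.
  (* Discarding the empty members leaves the union unchanged and makes every remaining member
     good. *)
  right; pose C' := [set H | C H /\ H !=set0].
  have -> : \bigcup_(H in C) H = \bigcup_(H in C') H.
    apply/seteqP; split=> b [H]; last by case=> CH _ Hb; exists H.
    by move=> CH Hb; exists H => //; split => //; exists b.
  have gC H : C' H -> good H.
    by case=> CH [b Hb]; case: (CP _ CH) => // H0; move: Hb; rewrite H0.
  split.
  + apply: lattice_filter_chain; first by exists G; split => //; exists a.
      by move=> H /gC[].
    by move=> H K [CH _] [CK _]; exact: tot.
  + move=> b Fb; exists G; first by split => //; exists a.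
    by case: gG => _ + _; exact.
  + by move=> b [H /gC[_ _ +] Hb]; exact.
(* The added empty set is not maximal: [F] is good and contains top. *)
- exfalso; apply: (Pmax F); last by right; split.
  by rewrite P0; split=> [//|/(_ _ (lfilter_top fF))].
- have [fP FP PI] := gP; exists P; split => //; split => //.
    by move=> /PI; exact.
  (* By maximality, adjoining an element outside [P] produces a filter that meets [I]. *)
  have hit a : ~ P a -> exists2 p, P p & I (p `&` a)%O.
    move=> nPa; apply: contrapT => nh.
    apply: (Pmax [set c | exists2 p, P p & (p `&` a <= c)%O]).
      split=> [b Pb|]; first by exists b => //; exact: leIl.
      move=> /(_ a) /=; apply: contra_not nPa; apply.
      by exists \top%O; [exact: lfilter_top|exact: leIr].
    right; split; first exact: lattice_filter_add.
      by move=> b /FP Pb; exists b => //; exact: leIl.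
    by move=> c [p Pp pac] Ic; apply: nh; exists p => //; exact: Idown pac.
  move=> a b Pab; apply: contrapT => /not_orP[/hit[p Pp Ipa] /hit[q Pq Iqb]].
  (* This element lies in [P], and by distributivity below the join of [p /\ a] and [q /\ b], which
     lies in [I]. *)
  apply: (PI ((p `&` q) `&` (a `|` b))%O).
    by apply: (lfilter_meet fP) => //; exact: lfilter_meet.
  apply: (Idown _ ((p `&` a) `|` (q `&` b))%O); first exact: IU.
  rewrite meetC; apply/res; rewrite leUx; apply/andP; split; apply/res.
    by rewrite lexU2 // meetC leI2 // leIl.
  by rewrite lexU2 // meetC [X in _ || X]leI2 ?orbT // leIr.
Qed.

Lemma residuated_meetC (A : bGalgebra) (a b c : A) :
  (a `&` b <= c)%O <-> (b <= imp a c)%O.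
Proof. by rewrite meetC; exact: godel_residuation (bGa_godel A) _ _ _. Qed.

Lemma modus_ponens (A : bGalgebra) (a b : A) : (a `&` imp a b <= b)%O.
Proof. exact/residuated_meetC. Qed.

(** * The spectrum of a bG-algebra *)

Record spectrum (A : bGalgebra) := Spectrum {
  spec_mem :> A -> Prop;
  specP : prime_filter spec_mem
}.

Lemma spec_eq (A : bGalgebra) (P Q : spectrum A) :
  (forall a, P a <-> Q a) -> P = Q.
Proof.
case: P Q => [P hP] [Q hQ] /= PQ.
have {}PQ : P = Q by apply/funext => a; apply/propext.
by case: _ / PQ hQ => hQ; congr Spectrum; exact: Prop_irrelevance.
Qed.

Section SpectrumTheory.
Variable A : bGalgebra.
Implicit Types (P Q : spectrum A) (a b c : A).

Lemma spec_top P : P \top%O.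
Proof. exact: lfilter_top (specP P). Qed.

Lemma spec_bot P : ~ P \bot%O.
Proof. exact: pfilter_bot (specP P). Qed.

Lemma spec_up P a b : (a <= b)%O -> P a -> P b.
Proof. by move=> ab Pa; exact: lfilter_up (specP P) _ _ Pa ab. Qed.

Lemma spec_meet P a b : P (a `&` b)%O <-> P a /\ P b.
Proof.
split=> [Pab|[Pa Pb]]; last exact: lfilter_meet (specP P) _ _ Pa Pb.
by split; apply: spec_up Pab; [exact: leIl|exact: leIr].
Qed.

Lemma spec_join P a b : P (a `|` b)%O <-> P a \/ P b.
Proof.
split; first exact: pfilter_join (specP P) _ _.
by case; apply: spec_up; [exact: leUl|exact: leUr].
Qed.

Lemma spec_imp P a b : P (imp a b) -> P a -> P b.
Proof. by move=> Pab Pa; apply: spec_up (modus_ponens a b) _; apply/spec_meet. Qed.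

(** The filter generated by [P] and [a] avoids the principal ideal of [b]: if [p /\ a <= b] with [p]
    in [P], residuation puts [imp a b] in [P]. *)
Lemma spec_impN P a b : ~ P (imp a b) ->
  exists Q : spectrum A, [/\ forall c, P c -> Q c, Q a & ~ Q b].
Proof.
move=> nPab.
have [||c [p Pp pac] cb|Q [pQ PQ QI]] := prime_filter_separation
  (F := [set c | exists2 p, P p & (p `&` a <= c)%O])
  (I := [set c | (c <= b)%O]) (godel_residuation (bGa_godel A)).
- exact: lattice_filter_add (specP P).
- split=> [|c d /= db cd|c d /= cb db]; first exact: le0x.
    exact: le_trans cd db.
  by rewrite leUx cb.
- apply: nPab; apply: spec_up Pp.
  by apply/(godel_residuation (bGa_godel A)); exact: le_trans pac cb.
exists (Spectrum pQ); split => /=.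
- by move=> c Pc; apply: PQ; exists c => //; exact: leIl.
- by apply: PQ; exists \top%O; [exact: spec_top|exact: leIr].
- by move=> /QI; apply => /=; exact: lexx.
Qed.

Lemma spec_separation a b : ~ (a <= b)%O -> exists2 P : spectrum A, P a & ~ P b.
Proof.
move=> nab.
have [||c /= ac cb|P [pP aP PI]] := prime_filter_separation
  (F := [set c | (a <= c)%O]) (I := [set c | (c <= b)%O])
  (godel_residuation (bGa_godel A)).
- split=> [|c d /= ac cd|c d /= ac ad]; first exact: lex1.
    exact: le_trans ac cd.
  by rewrite lexI ac.
- split=> [|c d /= db cd|c d /= cb db]; first exact: le0x.
    exact: le_trans cd db.
  by rewrite leUx cb.
- by apply: nab; exact: le_trans ac cb.
exists (Spectrum pP) => /=; first by apply: aP => /=; exact: lexx.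
by move=> /PI; apply => /=; exact: lexx.
Qed.

End SpectrumTheory.

(** * Inclusion order and topology on the prime filters *)

HB.instance Definition _ (A : bGalgebra) := gen_eqMixin (spectrum A).
HB.instance Definition _ (A : bGalgebra) := gen_choiceMixin (spectrum A).

Definition spec_le (A : bGalgebra) (P Q : spectrum A) : bool :=
  `[< forall a, P a -> Q a >].

Lemma spec_le_refl (A : bGalgebra) : reflexive (@spec_le A).
Proof. by move=> P; apply/asboolP. Qed.

Lemma spec_le_anti (A : bGalgebra) : antisymmetric (@spec_le A).
Proof.
move=> P Q /andP[/asboolP PQ /asboolP QP]; apply: spec_eq => a.
by split; [exact: PQ|exact: QP].
Qed.

Lemma spec_le_trans (A : bGalgebra) : transitive (@spec_le A).
Proof.
by move=> Q P R /asboolP PQ /asboolP QR; apply/asboolP => a /PQ/QR.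
Qed.

HB.instance Definition _ (A : bGalgebra) :=
  Order.Le_isPOrder.Build disp (spectrum A)
    (@spec_le_refl A) (@spec_le_anti A) (@spec_le_trans A).

Definition spec_nbhs (A : bGalgebra) (P : spectrum A) : set_system (spectrum A) :=
  [set N | exists a b, [/\ P a, ~ P b & forall Q : spectrum A, Q a -> ~ Q b -> N Q]].

HB.instance Definition _ (A : bGalgebra) :=
  hasNbhs.Build (spectrum A) (@spec_nbhs A).

(** The sets given by pairs [(a, b)] form a base and not merely a subbase: the intersection for
    [(a, b)] and [(c, d)] is the set for [(a /\ c, b \/ d)]. *)
Lemma spec_nbhs_filter (A : bGalgebra) (P : spectrum A) :
  ProperFilter (nbhs P).
Proof.
apply: Build_ProperFilter_ex => [N [a [b [Pa Pb N_]]]|]; first by exists P; exact: N_.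
split.
- exists \top%O, \bot%O; split=> //; [exact: spec_top|exact: spec_bot].
- move=> M N [a [b [Pa Pb M_]]] [c [d [Pc Pd N_]]].
  exists (a `&` c)%O, (b `|` d)%O; split; first exact/spec_meet.
    by move/spec_join => [].
  move=> Q /spec_meet[Qa Qc] /spec_join/not_orP[Qb Qd].
  by split; [exact: M_|exact: N_].
- move=> M N MN [a [b [Pa Pb M_]]]; exists a, b; split=> // Q Qa Qb.
  by apply: MN; exact: M_.
Qed.

Lemma spec_nbhs_singleton (A : bGalgebra) (P : spectrum A) (N : set (spectrum A)) :
  nbhs P N -> N P.
Proof. by move=> [a [b [Pa Pb]]]; exact. Qed.

Lemma spec_nbhs_nbhs (A : bGalgebra) (P : spectrum A) (N : set (spectrum A)) :
  nbhs P N -> nbhs P (nbhs^~ N).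
Proof.
by move=> [a [b [Pa Pb N_]]]; exists a, b; split=> // Q Qa Qb; exists a, b.
Qed.

HB.instance Definition _ (A : bGalgebra) :=
  Nbhs_isNbhsTopological.Build (spectrum A) (@spec_nbhs_filter A)
    (@spec_nbhs_singleton A) (@spec_nbhs_nbhs A).

(* [compact_cover] assumes a pointed space, while the spectrum of the trivial
   algebra is empty. *)
Lemma compact_finite_subcover (T : topologicalType) (I : eqType) (D : set I)
    (f : I -> set T) (K : set T) :
  compact K -> (forall i, D i -> open (f i)) -> K `<=` \bigcup_(i in D) f i ->
  exists2 s : seq I, (forall i, i \in s -> D i) &
    forall x, K x -> exists2 i, i \in s & f i x.
Proof.
move=> cK of_ KD; apply: contrapT => nocover.
(* If no finite subfamily covers [K], the uncovered remainders generate a proper filter. A cluster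
   point lies in some [f i], yet the remainder of [[:: i]] misses [f i]. *)
pose rest (s : seq I) := [set x | K x /\ forall i, i \in s -> ~ f i x].
pose F := [set S : set T | exists2 s : seq I, (forall i, i \in s -> D i) &
  rest s `<=` S].
have FF : ProperFilter F.
  apply: Build_ProperFilter_ex => [S [s sD sS]|].
    apply: contrapT => S0; apply: nocover; exists s => // x Kx.
    apply: contrapT => nsx; apply: S0; exists x; apply: sS; split => //.
    by move=> i si fix_; apply: nsx; exists i.
  split; first by exists [::].
  - move=> S S' [s sD sS] [s' sD' sS']; exists (s ++ s').
      by move=> i; rewrite mem_cat => /orP[/sD|/sD'].
    move=> x [Kx ssx]; split; [apply: sS|apply: sS']; split=> // i si;
      by apply: ssx; rewrite mem_cat si ?orbT.
  - by move=> S S' SS' [s sD sS]; exists s => //; exact: subset_trans SS'.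
have [|x [Kx clx]] := cK F FF; first by exists [::] => // x [].
have [i Di fix_] := KD _ Kx.
have [||y [[_ nfi fiy]]] := clx (rest [:: i]) (f i).
- by exists [:: i] => // j; rewrite inE => /eqP ->.
- by apply: open_nbhs_nbhs; split => //; exact: of_.
- by apply: (nfi i); rewrite ?inE.
Qed.

(** * The spectrum as a bG-space *)

Section SpectrumSpace.
Variable A : bGalgebra.
Implicit Types (P Q R : spectrum A) (a b c : A).

Lemma spec_leP P Q : (P <= Q)%O <-> forall a, P a -> Q a.
Proof. by split=> [/asboolP|PQ]; last exact/asboolP. Qed.

Definition stone a : set (spectrum A) := [set P | P a].

Lemma open_stoneD a b : open (stone a `\` stone b).
Proof. by rewrite openE => P [Pa Pb]; exists a, b. Qed.

Lemma clopen_stone a : clopen (stone a).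
Proof.
have oa : open (stone a).
  rewrite (_ : stone a = stone a `\` stone \bot%O); first exact: open_stoneD.
  by apply/seteqP; split=> [P Pa|P []//]; split => //; exact: spec_bot.
split => //; rewrite -openC (_ : ~` _ = stone \top%O `\` stone a).
  exact: open_stoneD.
by apply/seteqP; split=> [P Pa|P []//]; split => //; exact: spec_top.
Qed.

Lemma stone_up_set a : up_set (stone a).
Proof. by move=> P Q Pa /spec_leP; exact. Qed.

Lemma stone_le a b : stone a `<=` stone b <-> (a <= b)%O.
Proof.
split=> [ab|ab P]; last exact: spec_up ab.
apply: contrapT => /spec_separation[P Pa nPb]; exact: nPb (ab P Pa).
Qed.

(* An ultrafilter [U] of points converges to the prime filter
   [{a | U (stone a)}]. *)
Lemma spec_compact : compact [set: spectrum A].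
Proof.
rewrite compact_ultra => U UU _.
have fU : Filter U by exact: (@filter_filter _ _ ultra_proper).
have pP : prime_filter (fun a => U (stone a)).
  split; first split.
  - by apply: filterS filterT => P _; exact: spec_top.
  - by move=> a b Ua ab; apply: filterS Ua; exact/stone_le.
  - move=> a b Ua Ub; apply: filterS (filterI Ua Ub) => P [Pa Pb].
    exact/spec_meet.
  - move=> U0; have [P] := filter_ex U0; exact: spec_bot.
  - move=> a b Uab; have [|nUa] := in_ultra_setVsetC (stone a) UU; first by left.
    right; apply: filterS (filterI Uab nUa) => P [] /spec_join[]//.
exists (Spectrum pP); split => // N [a [b [/= Ua nUb N_]]].
have [//|{}nUb] := in_ultra_setVsetC (stone b) UU.
by apply: filterS (filterI Ua nUb) => P [Pa Pb]; exact: N_.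
Qed.

Lemma spec_priestley : priestley_space (spectrum A).
Proof.
split=> [|P Q nPQ]; first exact: spec_compact.
have [a nPQa] : exists a, ~ (P a -> Q a).
  by apply/existsNP => PQ; apply/nPQ/spec_leP.
exists (stone a); split; [exact: clopen_stone|exact: stone_up_set| |].
  by apply: contrapT => nPa; apply: nPQa.
by move=> Qa; apply: nPQa.
Qed.

Lemma spec_bigmeet P (I : Type) (s : seq I) (f : I -> A) :
  P (\big[Order.meet / \top%O]_(i <- s) f i) <-> all (fun i => `[< P (f i) >]) s.
Proof.
elim: s => [|i s IH]; first by rewrite big_nil; split=> // _; exact: spec_top.
rewrite big_cons /=; split=> [/spec_meet[Pi /IH Ps]|/andP[/asboolP Pi /IH Ps]].
  by rewrite Ps andbT; exact/asboolP.
exact/spec_meet.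
Qed.

(* A clopen set is a finite union of sets [stone a `\` stone b], and the
   down-closure of such a set is the complement of [stone (imp a b)]. *)
Lemma spec_down_closure (C : set (spectrum A)) :
  clopen C -> exists c, down_closure C = ~` stone c.
Proof.
move=> [oC cC].
have cptC : compact C by exact: subclosed_compact cC spec_compact _.
have [ab _|P|D sD CD] := compact_finite_subcover
  (D := [set ab : A * A | stone ab.1 `\` stone ab.2 `<=` C])
  (f := fun ab => stone ab.1 `\` stone ab.2) cptC.
- exact: open_stoneD.
- move: oC; rewrite openE => /[apply] -[a [b [Pa Pb abC]]].
  by exists (a, b) => // Q [/= Qa Qb]; exact: abC.
(* Down-closure commutes with the finite union, and complementation turns that union into the meet
   of the implications. *)
exists (\big[Order.meet / \top%O]_(ab <- D) imp ab.1 ab.2).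
apply/seteqP; split=> P.
  move=> [Q /CD[[a b] /= Dab [/= Qa Qb]] /spec_leP PQ] /spec_bigmeet/allP.
  move=> /(_ _ Dab)/asboolP /= /PQ Qab; apply: Qb; exact: spec_imp Qab Qa.
move=> /= /spec_bigmeet/negP/allPn[[a b] Dab /asboolPn /spec_impN[Q [PQ Qa Qb]]].
exists Q; last exact/spec_leP.
exact: (sD _ Dab).
Qed.

(** The complement of [U] is a clopen down-set, hence its own down-closure, so [spec_down_closure]
    describes it. *)
Lemma stone_surjective (U : set (spectrum A)) :
  clopen U -> up_set U -> exists a, stone a = U.
Proof.
move=> cU upU; have [c Uc] := spec_down_closure (clopenC setT cU).
exists c; rewrite -[LHS]setCK -Uc -[RHS]setCK; congr (~` _).
apply/seteqP; split=> [P [Q nUQ PQ] UP|P nUP]; last by exists P.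
by apply: nUQ; exact: upU UP PQ.
Qed.

Lemma spec_esakia : esakia_space (spectrum A).
Proof.
split=> [|U /spec_down_closure[c ->]]; first exact: spec_priestley.
exact: clopenC setT (clopen_stone c).
Qed.

(** Take [a] in [Q] but not in [R] and [b] in [R] but not in [Q]. By prelinearity [P] contains
    [imp a b] or [imp b a], and modus ponens in [Q] or in [R] gives a contradiction. *)
Lemma spec_forest : forest (spectrum A).
Proof.
move=> P Q R /spec_leP PQ /spec_leP PR; apply: contrapT => /not_orP[].
move=> /spec_leP/existsNP[a /not_implyP[Qa nRa]].
move=> /spec_leP/existsNP[b /not_implyP[Rb nQb]].
have := spec_top P; rewrite -(godel_prelinearity (bGa_godel A) a b).
by move=> /spec_join[/PQ/spec_imp/(_ Qa)|/PR/spec_imp/(_ Rb)].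
Qed.

Definition spec_D : set (spectrum A) := ~` stone bconst.

(** If [Q] is below [P] and omits some [a] of [P], then [Q], and hence [P], contains [imp a bconst],
    so [P] contains [bconst]. *)
Lemma spec_D_minimal P : spec_D P -> minimal_elt P.
Proof.
move=> nPf Q /spec_leP QP; apply: spec_eq => a; split; first exact: QP.
move=> Pa; apply: contrapT => nQa; apply: nPf.
have := spec_top Q; rewrite -(bGa_bool a) => /spec_join[//|/QP].
by move=> /spec_imp; exact.
Qed.

Definition spec_space : bGspace :=
  BGSpace spec_esakia spec_forest (clopenC setT (clopen_stone bconst))
    spec_D_minimal.

End SpectrumSpace.

(** * Preimage of prime filters along a homomorphism *)

Section SpectrumMap.
Variables (A B : bGalgebra) (h : bGhom A B).

Lemma spec_preimage_prime (P : spectrum B) : prime_filter (fun a => P (h a)).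
Proof.
have [hI hU him hT hB hc] := bGhomP h.
split; first split; rewrite ?hT ?hB.
- exact: spec_top.
- move=> a b Pa ab; have : h a = (h a `&` h b)%O by rewrite -hI meet_l.
  by move=> hab; move: Pa; rewrite hab => /spec_meet[].
- by move=> a b Pa Pb; rewrite hI; exact/spec_meet.
- exact: spec_bot.
- by move=> a b; rewrite hU => /spec_join.
Qed.

Definition spec_preimage (P : spectrum B) : spectrum A :=
  Spectrum (spec_preimage_prime P).

Lemma is_bGmorphism_spec_preimage :
  is_bGmorphism (spec_preimage : spec_space B -> spec_space A).
Proof.
have [hI hU him hT hB hc] := bGhomP h.
split.
- move=> P N [a [b [Pa Pb N_]]]; exists (h a), (h b); split=> // Q Qa Qb.
  exact: N_.
- by move=> P Q /spec_leP PQ; apply/spec_leP => a; exact: PQ.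
(* For the lifting, separate the filter generated by [P] and [h[Q]] from the ideal generated by the
   image of the complement of [Q], an ideal because [Q] is prime. They are disjoint:
   [p /\ h q <= h r] gives [p <= h (imp q r)], so [imp q r] and then [r] lie in [Q]. *)
- move=> P Q /spec_leP PQ.
  have [||c [p Pp [q Qq pqc]] [r nQr cr]|R [pR FR RI]] :=
    prime_filter_separation
      (F := [set c | exists2 p, P p & exists2 q, Q q & (p `&` h q <= c)%O])
      (I := [set c | exists2 r, ~ Q r & (c <= h r)%O])
      (godel_residuation (bGa_godel B)).
  + split.
    * exists \top%O; first exact: spec_top.
      by exists \top%O; [exact: spec_top|exact: lex1].
    * move=> a b [p Pp [q Qq pqa]] ab; exists p => //; exists q => //.
      exact: le_trans ab.
    * move=> a b [p Pp [q Qq pqa]] [p' Pp' [q' Qq' pqb]].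
      exists (p `&` p')%O; first exact/spec_meet.
      exists (q `&` q')%O; first exact/spec_meet.
      by rewrite hI meetACA leI2.
  + split.
    * by exists \bot%O; [exact: spec_bot|exact: le0x].
    * by move=> a b [r nQr br] ab; exists r => //; exact: le_trans br.
    * move=> a b [r nQr ar] [r' nQr' br]; exists (r `|` r')%O.
        by move/spec_join => [].
      by rewrite hU leU2.
  + apply: nQr; apply: spec_imp Qq; apply: PQ => /=.
    apply: spec_up Pp; rewrite him.
    by apply/(godel_residuation (bGa_godel B)); exact: le_trans pqc cr.
  exists (Spectrum pR).
    by apply/spec_leP => a Pa /=; apply: FR; exists a => //; exists \top%O;
      [exact: spec_top|exact: leIl].
  apply: spec_eq => a /=; split=> [Ra|Qa].
    by apply: contrapT => nQa; apply: (RI _ Ra); exists a.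
  by apply: FR; exists \top%O; [exact: spec_top|exists a => //; exact: leIr].
- by move=> _ [P nPf <-]; move: nPf; rewrite /bGs_D /= /spec_D /stone /= hc.
- by move=> _ [P nPf <-]; move: nPf; rewrite /bGs_D /= /spec_D /stone /= hc.
Qed.

Definition spec_map : bGmorphism (spec_space B) (spec_space A) :=
  BGMorphism is_bGmorphism_spec_preimage.

End SpectrumMap.

Lemma spec_map_id (A : bGA) : spec_map (idm A) = idm (spec_space A : bGS).
Proof. by apply/bGm_eq/funext => P; exact: spec_eq. Qed.

Lemma spec_map_comp (A B C : bGA) (g : bGhom B C) (f : bGhom A B) :
  spec_map (bGhom_comp g f) = bGm_comp (spec_map f) (spec_map g).
Proof. by apply/bGm_eq/funext => P; exact: spec_eq. Qed.

Definition spec_functor : functor (opposite bGA) bGS :=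
  @Functor (opposite bGA) bGS spec_space (fun A B h => @spec_map B A h)
    spec_map_id (fun A B C g f => spec_map_comp f g).

(** * The algebra of clopen up-sets *)

Record clopup (X : POrderedTopological.type disp) := ClopUp {
  clopup_set :> set X;
  clopup_clopen : clopen clopup_set;
  clopup_up : up_set clopup_set
}.

Lemma clopup_eq (X : POrderedTopological.type disp) (U V : clopup X) :
  U `<=>` V -> U = V.
Proof.
case: U V => [U cU uU] [V cV uV] /= /seteqP UV.
by case: _ / UV cV uV => cV uV; congr ClopUp; exact: Prop_irrelevance.
Qed.

HB.instance Definition _ (X : POrderedTopological.type disp) :=
  gen_eqMixin (clopup X).
HB.instance Definition _ (X : POrderedTopological.type disp) :=
  gen_choiceMixin (clopup X).

Section ClopUpLattice.
Variable X : POrderedTopological.type disp.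
Implicit Types U V W : clopup X.

Definition clopup_le U V : bool := `[< U `<=` V >].

Lemma clopup_le_refl : reflexive clopup_le.
Proof. by move=> U; apply/asboolP. Qed.

Lemma clopup_le_anti : antisymmetric clopup_le.
Proof.
by move=> U V /andP[/asboolP UV /asboolP VU]; apply: clopup_eq; split.
Qed.

Lemma clopup_le_trans : transitive clopup_le.
Proof.
by move=> V U W /asboolP UV /asboolP VW; apply/asboolP; exact: subset_trans VW.
Qed.

HB.instance Definition _ :=
  Order.Le_isPOrder.Build disp (clopup X)
    clopup_le_refl clopup_le_anti clopup_le_trans.

Lemma clopup_leP U V : (U <= V)%O <-> U `<=` V.
Proof. by split=> [/asboolP|UV]; last exact/asboolP. Qed.

Lemma clopup_meet_up U V : up_set (U `&` V).
Proof. by move=> x y [Ux Vx] xy; split; apply: clopup_up xy. Qed.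

Lemma clopup_join_up U V : up_set (U `|` V).
Proof. by move=> x y [Ux|Vx] xy; [left|right]; apply: clopup_up xy. Qed.

Definition clopup_meet U V : clopup X :=
  ClopUp (clopenI (clopup_clopen U) (clopup_clopen V)) (@clopup_meet_up U V).

Definition clopup_join U V : clopup X :=
  ClopUp (clopenU (clopup_clopen U) (clopup_clopen V)) (@clopup_join_up U V).

Lemma clopup_meetP U V W :
  (U <= clopup_meet V W)%O = (U <= V)%O && (U <= W)%O.
Proof.
apply/idP/andP => [/clopup_leP UVW|[/clopup_leP UV /clopup_leP UW]].
  by split; apply/clopup_leP => x /UVW[].
by apply/clopup_leP => x Ux; split; [exact: UV|exact: UW].
Qed.

Lemma clopup_joinP U V W :
  (clopup_join U V <= W)%O = (U <= W)%O && (V <= W)%O.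
Proof.
apply/idP/andP => [/clopup_leP UVW|[/clopup_leP UW /clopup_leP VW]].
  by split; apply/clopup_leP => x ?; apply: UVW; [left|right].
by apply/clopup_leP => x []; [exact: UW|exact: VW].
Qed.

HB.instance Definition _ :=
  Order.POrder_MeetJoin_isLattice.Build disp (clopup X)
    clopup_meetP clopup_joinP.

Lemma clopup0_up : up_set (set0 : set X).
Proof. by []. Qed.

Lemma clopupT_up : up_set (setT : set X).
Proof. by []. Qed.

Definition clopup0 : clopup X := ClopUp (conj open0 closed0) clopup0_up.
Definition clopupT : clopup X := ClopUp (conj openT closedT) clopupT_up.

Lemma clopup_le0 U : (clopup0 <= U)%O.
Proof. exact/clopup_leP. Qed.

Lemma clopup_leT U : (U <= clopupT)%O.
Proof. exact/clopup_leP. Qed.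

HB.instance Definition _ := Order.hasBottom.Build disp (clopup X) clopup_le0.
HB.instance Definition _ := Order.hasTop.Build disp (clopup X) clopup_leT.

End ClopUpLattice.

Section ClopUpAlgebra.
Variable X : bGspace.
Implicit Types U V W : clopup X.

(** This is where the Esakia condition on [X] enters. *)
Lemma clopup_imp_clopen U V : clopen (~` down_closure (U `\` V)).
Proof.
apply: clopenC setT _; apply: (bGs_esakia X).2; rewrite setDE.
by apply: clopenI; [exact: clopup_clopen|apply: clopenC setT (clopup_clopen V)].
Qed.

Lemma up_setC_down_closure (S : set X) : up_set (~` down_closure S).
Proof.
by move=> x y nx xy [z Sz yz]; apply: nx; exists z => //; exact: le_trans yz.
Qed.

Definition clopup_imp U V : clopup X :=
  ClopUp (clopup_imp_clopen U V) (@up_setC_down_closure (U `\` V)).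

(** The Kripke clause for implication, from which residuation, prelinearity and preservation under
    p-morphisms are read off. *)
Lemma clopup_impP U V x :
  clopup_set (clopup_imp U V) x <->
  forall y, (x <= y)%O -> clopup_set U y -> clopup_set V y.
Proof.
split=> [nx y xy Uy|UV [y [Uy nVy] xy]]; last by apply: nVy; exact: UV.
by apply: contrapT => nVy; apply: nx; exists y.
Qed.

Lemma clopup_godel : is_godel_algebra clopup_imp.
Proof.
split=> [U V W|U V].
  split=> [/clopup_leP UVW|/clopup_leP UVW]; apply/clopup_leP.
    move=> x Ux; apply/clopup_impP => y xy Vy.
    by apply: UVW; split => //; exact: clopup_up xy.
  by move=> x [/UVW/clopup_impP + Vx]; apply.
(* If both implications fail at [x], there are points above [x] in [U \ V] and in [V \ U]. The
   forest condition makes them comparable, against [U] and [V] being up-sets. *)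
apply: clopup_eq; split=> // x _; apply: contrapT => /not_orP[].
move=> /clopup_impP/existsNP[y /not_implyP[xy /not_implyP[Uy nVy]]].
move=> /clopup_impP/existsNP[z /not_implyP[xz /not_implyP[Vz nUz]]].
have [yz|zy] := bGs_forest xy xz.
  by apply: nUz; exact: clopup_up yz.
by apply: nVy; exact: clopup_up zy.
Qed.

Lemma setC_bGs_D_up : up_set (~` @bGs_D X).
Proof.
by move=> x y nDx xy Dy; apply: nDx; rewrite (bGs_minimal Dy xy).
Qed.

Definition clopup_const : clopup X :=
  ClopUp (clopenC setT (@bGs_clopen X)) setC_bGs_D_up.

(** If [x] is outside [U], a point of [U] above [x] differs from [x], so it is not minimal and lies
    outside [bGs_D]. *)
Lemma clopup_bool U : (U `|` clopup_imp U clopup_const)%O = \top%O.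
Proof.
apply: clopup_eq; split=> // x _.
have [|nUx] := pselect (clopup_set U x); [by left|right].
apply/clopup_impP => y xy Uy Dy; apply: nUx.
by rewrite (bGs_minimal Dy xy).
Qed.

Definition clopup_alg : bGalgebra := BGAlgebra clopup_godel clopup_bool.

End ClopUpAlgebra.

(** * Preimage of clopen up-sets along a morphism *)

Section ClopUpMap.
Variables (X Y : bGspace) (f : bGmorphism X Y).

Lemma clopup_preimage_clopen (U : clopup Y) : clopen (f @^-1` U).
Proof.
have fc := bGm_continuous (bGmP f); have [oU cU] := clopup_clopen U.
by split; [move/continuousP: fc|move/continuous_closedP: fc]; apply.
Qed.

Lemma clopup_preimage_up (U : clopup Y) : up_set (f @^-1` U).
Proof.
by move=> x y Ux xy; apply: clopup_up Ux _; exact: bGm_isotone (bGmP f) _ _ xy.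
Qed.

Definition clopup_preimage (U : clopup Y) : clopup X :=
  ClopUp (clopup_preimage_clopen U) (@clopup_preimage_up U).

(** Isotony and lifting give the two inclusions for implication; the two conditions on [bGs_D] give
    those for the constant. *)
Lemma is_bGhom_clopup_preimage :
  is_bGhom (clopup_preimage : clopup_alg Y -> clopup_alg X).
Proof.
have [fc fi fl fD fC] := bGmP f.
split=> [U V|U V|U V|||]; apply: clopup_eq; split=> // x.
- move=> /clopup_impP UV; apply/clopup_impP => y /fi; exact: UV.
- move=> /clopup_impP UV; apply/clopup_impP => z /fl[y xy <-]; exact: UV.
- by move=> nDx Dx; apply: nDx; apply: fD; exists x.
- by move=> nDx; apply: fC; exists x.
Qed.

Definition clopup_map : bGhom (clopup_alg Y) (clopup_alg X) :=
  BGHom is_bGhom_clopup_preimage.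

End ClopUpMap.

Lemma clopup_map_id (X : bGS) : clopup_map (idm X) = idm (clopup_alg X : bGA).
Proof. by apply/bGhom_eq/funext => U; apply: clopup_eq; split. Qed.

Lemma clopup_map_comp (X Y Z : bGS) (g : bGmorphism Y Z) (f : bGmorphism X Y) :
  clopup_map (bGm_comp g f) = bGhom_comp (clopup_map f) (clopup_map g).
Proof. by apply/bGhom_eq/funext => U; apply: clopup_eq; split. Qed.

Definition clopup_functor : functor bGS (opposite bGA) :=
  @Functor bGS (opposite bGA) clopup_alg (fun X Y f => clopup_map f)
    clopup_map_id clopup_map_comp.

(** * The natural isomorphisms *)

Lemma is_iso_opposite (C : category) (X Y : C) (f : hom X Y) :
  is_iso f -> @is_iso (opposite C) Y X f.
Proof. by move=> [g [gf fg]]; exists g. Qed.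

(** The Stone map, read in the opposite category, and the point map both run against the direction
    that [equivalent] asks for; this turns them around. *)
Lemma naturally_isomorphic_sym (C D : category) (F G : functor C D) :
  naturally_isomorphic F G -> naturally_isomorphic G F.
Proof.
move=> [eta [nat_eta iso_eta]].
pose inv X := sval (cid (iso_eta X)); have invP X := svalP (cid (iso_eta X)).
exists inv; split=> [X Y f|X].
  rewrite -[fmap G f]compose_idr -(invP X).2 (composeA (fmap G f)) -nat_eta.
  by rewrite -(composeA (eta Y)) (composeA (inv Y)) (invP Y).1 compose_idl.
by exists (eta X); have [] := invP X.
Qed.

Lemma bGhom_bij_iso (A B : bGA) (h : bGhom A B) : bijective h ->
  @is_iso bGA A B h.
Proof.
move=> [g hK gK]; have [hI hU him hT hB hc] := bGhomP h.
have gP : is_bGhom g.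
  by split=> [a b|a b|a b|||]; apply: (can_inj hK);
    rewrite ?(hI, hU, him, hT, hB, hc) !gK.
by exists (BGHom gP); split; apply/bGhom_eq/funext => a /=; rewrite ?hK ?gK.
Qed.

(** * The unit on algebras *)

Section StoneMap.
Variable A : bGalgebra.

Definition stone_clopup (a : A) : clopup_alg (spec_space A) :=
  ClopUp (clopen_stone a) (@stone_up_set A a).

Lemma is_bGhom_stone : is_bGhom stone_clopup.
Proof.
split=> [a b|a b|a b|||]; apply: clopup_eq.
- by split=> P /spec_meet.
- by split=> P /spec_join.
- split=> P; last first.
    (* The prime filter [Q] above [P] given by [spec_impN] refutes the Kripke clause. *)
    move=> /clopup_impP Pab; apply: contrapT => /spec_impN[Q [PQ Qa nQb]].
    by apply: nQb; apply: Pab => //; exact/spec_leP.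
  move=> Pab; apply/clopup_impP => Q /spec_leP PQ; exact: spec_imp (PQ _ Pab).
- by split=> P // _; exact: spec_top.
- by split=> P // /spec_bot.
- by rewrite /= /spec_D setCK; split.
Qed.

Definition stone_hom : bGhom A (clopup_alg (spec_space A)) :=
  BGHom is_bGhom_stone.

Lemma stone_hom_iso : @is_iso bGA A (clopup_alg (spec_space A)) stone_hom.
Proof.
apply: bGhom_bij_iso.
have /choice[g gP] (U : clopup_alg (spec_space A)) :
    exists a, stone_clopup a = U.
  have [a aU] := stone_surjective (clopup_clopen U) (@clopup_up _ U).
  by exists a; apply: clopup_eq; rewrite /= aU; split.
exists g => // a; apply/le_anti/andP.
have [] : stone (g (stone_clopup a)) `<=>` stone a.
  by have := congr1 (@clopup_set _) (gP (stone_clopup a)) => /= ->; split.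
by move=> /stone_le + /stone_le.
Qed.

End StoneMap.

Lemma stone_hom_natural (A B : bGA) (h : bGhom A B) :
  bGhom_comp (clopup_map (spec_map h)) (stone_hom A) =
  bGhom_comp (stone_hom B) h.
Proof. by apply/bGhom_eq/funext => a; apply: clopup_eq; split. Qed.

(** For distinct points one of the two inequalities fails, and a clopen up-set or its complement
    contains [x] and omits [y]. *)
Lemma priestley_hausdorff (X : POrderedTopological.type disp) :
  priestley_space X -> hausdorff_space X.
Proof.
move=> [_ sep] x y clxy; apply: contrapT => nxy.
have [U [[oU cU] ux uy]] : exists U : set X, [/\ clopen U, U x & ~ U y].
  have [xy|nle] := pselect (x <= y)%O.
    have [|U [cU _ Uy nUx]] := sep y x.
      by move=> yx; apply: nxy; apply/le_anti/andP.
    exists (~` U); split; [exact: clopenC setT cU|by []|by apply].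
  by have [U [cU _ Ux nUy]] := sep _ _ nle; exists U.
have [||z []//] := clxy U (~` U); apply: open_nbhs_nbhs; split => //.
exact: closed_openC.
Qed.

(** * The unit on spaces *)

Section PointMap.
Variable X : bGspace.

Lemma point_prime (x : X) :
  prime_filter (fun U : clopup_alg X => clopup_set U x).
Proof.
split=> //; split=> // U V Ux /clopup_leP; exact.
Qed.

Definition point_spec (x : X) : spec_space (clopup_alg X) :=
  Spectrum (point_prime x).

Lemma point_spec_le (x y : X) : (point_spec x <= point_spec y)%O <-> (x <= y)%O.
Proof.
split=> [/spec_leP xy|xy]; last by apply/spec_leP => U Ux; exact: clopup_up xy.
apply: contrapT => /(bGs_esakia X).1.2[U [cU upU Ux nUy]].
exact: nUy (xy (ClopUp cU upU) Ux).
Qed.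

Lemma point_spec_continuous : continuous point_spec.
Proof.
move=> x N [U [V [Ux nVx N_]]]; apply: (@filterS _ _ _ (U `\` V)).
  by move=> y [Uy nVy]; exact: N_.
apply: open_nbhs_nbhs; split => //; rewrite setDE.
have [oU _] := clopup_clopen U; have [_ cV] := clopup_clopen V.
by apply: openI => //; exact: closed_openC.
Qed.

(** A continuous map from a compact space to a Hausdorff one is closed. This yields surjectivity and
    the continuity of the inverse. *)
Lemma point_spec_closed (C : set X) : closed C -> closed (point_spec @` C).
Proof.
move=> cC; apply: compact_closed.
  exact: priestley_hausdorff (spec_priestley _).
apply: continuous_compact; last exact: subclosed_compact cC (bGs_esakia X).1.1 _.
by apply: continuous_subspaceT; exact: point_spec_continuous.
Qed.

(* The range is closed, and dense because [a \in P], [b \notin P] force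
   [a `\` b] to be nonempty. *)
Lemma point_spec_surjective (P : spec_space (clopup_alg X)) :
  exists x, point_spec x = P.
Proof.
suff : closure (range point_spec) P.
  rewrite -(closure_id _).1; first by move=> [x _ <-]; exists x.
  by apply: point_spec_closed; exact: closedT.
move=> N [U [V [PU nPV N_]]].
have [x [Ux nVx]] : exists x, clopup_set U x /\ ~ clopup_set V x.
  apply: contrapT => UV; apply: nPV; apply: spec_up PU; apply/clopup_leP => x Ux.
  by apply: contrapT => nVx; apply: UV; exists x.
by exists (point_spec x); split; [exists x|exact: N_].
Qed.

Lemma is_bGmorphism_point : is_bGmorphism point_spec.
Proof.
split.
- exact: point_spec_continuous.
- by move=> x y /point_spec_le.
(* Lifting comes for free from a surjective order embedding. *)
- move=> x P; have [y <-] := point_spec_surjective P.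
  by move=> /point_spec_le xy; exists y.
- by move=> _ [x Dx <-] /=; apply.
- by move=> _ [x Dx <-] /=; apply.
Qed.

Definition point_morphism : bGmorphism X (spec_space (clopup_alg X)) :=
  BGMorphism is_bGmorphism_point.

Lemma point_morphism_iso :
  @is_iso bGS X (spec_space (clopup_alg X)) point_morphism.
Proof.
have [g gK] := choice point_spec_surjective.
have Kg x : g (point_spec x) = x.
  by apply/le_anti/andP; split; apply/point_spec_le; rewrite gK.
have gP : is_bGmorphism g.
  split.
  (* The preimage of [C] under [g] is its image under [point_spec], which is closed. *)
  - apply/continuous_closedP => C /point_spec_closed.
    congr closed; apply/seteqP; split=> [_ [x Cx <-] /=|P CP].
      by rewrite Kg.
    by exists (g P).
  - by move=> P Q PQ; apply/point_spec_le; rewrite !gK.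
  - move=> P x Px; exists (point_spec x) => //.
    by rewrite -[P]gK; exact/point_spec_le.
  - by move=> _ [P DP <-]; move: DP; rewrite -{1}[P]gK => /contrapT.
  - by move=> _ [P DP <-]; move: DP; rewrite -{1}[P]gK => DP D; apply: DP => /(_ D).
by exists (BGMorphism gP); split; apply/bGm_eq/funext => x /=; rewrite ?gK ?Kg.
Qed.

End PointMap.

Lemma point_morphism_natural (X Y : bGS) (f : bGmorphism X Y) :
  bGm_comp (point_morphism Y) f =
  bGm_comp (spec_map (clopup_map f)) (point_morphism X).
Proof. by apply/bGm_eq/funext => x; exact: spec_eq. Qed.

Theorem mainTheorem9 : dually_equivalent bGA bGS.
Proof.
exists spec_functor, clopup_functor; split; apply: naturally_isomorphic_sym.
- exists (fun A => stone_hom A); split=> [A B h|A].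
    exact: stone_hom_natural.
  exact: is_iso_opposite (stone_hom_iso A).
- exists point_morphism; split; [exact: point_morphism_natural|].
  exact: point_morphism_iso.
Qed.
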